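(* Let $N$ be an even positive integer, let $R>0$ be a real number, let $A(0),A(1),\dots,A(N/2-1)$ be complex numbers with $A(u)=|A(u)|\exp(j\varphi_A(u))$, and let $$J(\tau)=\sum_{u=0}^{N/2-1}\Bigl(|A(u)|^2+R^2+2R|A(u)|\cos\bigl(\varphi_A(u)-\tfrac{2\pi}{N}\tau u\bigr)\Bigr),\qquad \tau=0,1,\dots,N-1.$$ Then $$A(u)=\frac1{NR}\sum_{\tau=0}^{N-1}J(\tau)\exp\bigl(j\tfrac{2\pi}{N}\tau u\bigr),\qquad 0<u\le N/2-1,$$ $$|A(0)+R|^2=\frac1N\sum_{\tau=0}^{N-1}J(\tau)-\Bigl(\sum_{u_1=1}^{N/2-1}|A(u_1)|^2+\sum_{u_1=1}^{N/2-1}R^2\Bigr).$$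
   Context: Here $j$ is the imaginary unit and $\varphi_A(u)\in\mathbb{R}$ is a phase (argument) of the complex number $A(u)$. *)

(* Defs.v *)
From mathcomp Require Import all_boot all_order all_algebra.
From mathcomp Require Import all_classical all_reals all_analysis complex.

Set Implicit Arguments.
Unset Strict Implicit.
Unset Printing Implicit Defensive.

Import Order.TTheory GRing.Theory Num.Theory.
Local Open Scope ring_scope.
Local Open Scope complex_scope.

(* The libraries provide [expR], [cos] and [sin] on a [realType] but no
   exponential on [R[i]]. *)
Definition expC (R : realType) (z : R[i]) : R[i] :=
  (expR (complex.Re z))%:C * (cos (complex.Im z) +i* sin (complex.Im z)).

Lemma expC0 (R : realType) : expC (0 : R[i]) = 1.
Proof. by rewrite /expC /= expR0 cos0 sin0 mul1r. Qed.

Lemma expCD (R : realType) (z w : R[i]) : expC (z + w) = expC z * expC w.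
Proof.
case: z w => [a b] [c d]; rewrite /expC /= expRD cosD sinD rmorphM mulrACA.
by congr (_ * _); apply/eqP; rewrite eq_complex /= eqxx addrC eqxx.
Qed.

(* Main.v *)
Require Import Defs.
From mathcomp Require Import all_boot all_order all_algebra.
From mathcomp Require Import all_classical all_reals all_analysis complex.
From mathcomp Require Import ring lra zify.
Import Order.TTheory GRing.Theory Num.Theory.
Import ComplexField.
Local Open Scope ring_scope.
Local Open Scope complex_scope.

(** Writing J for the given real sequence, theta = 2 pi / N and
    cis x = cos x + i sin x, the idea is to expand the cosine in J:

      2 r |A v| cos (phi v - theta t v)
        = r (A v cis (- theta t v) + conj (A v) cis (theta t v)).

    Thus J is a trigonometric polynomial in t whose coefficient at frequency
    - v is r A v and whose coefficient at frequency v is r conj (A v), for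
    v < N/2, plus the constant sum of the |A v|^2 + r^2. The characters
    t |-> cis (theta t k) with |k| < N sum to 0 over a full period unless
    k = 0 ([sum_cis]). Multiplying J by cis (theta t u) and summing produces
    the integer frequencies u - v and u + v; because both indices are below
    N/2, these stay strictly between - N and N, so there is no aliasing. The
    frequency u - v isolates A u, while u + v vanishes only for u = v = 0.
    This gives one formula for the sum at every u < N/2 ([dft_power]).

    For u > 0 that formula reads N r A u. For u = 0 it reads
    N (sum over v of (|A v|^2 + r^2) + 2 r Re (A 0)), and the v = 0 term of
    the constant completes the square |A 0 + r|^2. *)

Definition cis {R : realType} (x : R) : R[i] := cos x +i* sin x.

Lemma expC_im {R : realType} (x : R) : expC ('i%C * x%:C) = cis x.
Proof.
rewrite /expC /=.
by rewrite !(mul0r, mul1r, mulr0, add0r, oppr0) expR0 mul1r.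
Qed.

Lemma cisD {R : realType} (x y : R) : cis (x + y) = cis x * cis y.
Proof.
by rewrite /cis cosD sinD; apply/eqP; rewrite eq_complex /= eqxx addrC eqxx.
Qed.

Lemma cis0 {R : realType} : cis (0 : R) = 1.
Proof. by rewrite /cis cos0 sin0. Qed.

Lemma cis_natM {R : realType} (n : nat) (x : R) : cis (n%:R * x) = cis x ^+ n.
Proof.
elim: n => [|n IHn]; first by rewrite mul0r cis0.
by rewrite exprS -IHn -cisD -[n.+1%:R]natr1 mulrDl mul1r addrC.
Qed.

Lemma cis_period {R : realType} (k : int) : cis (2 * pi * k%:~R : R) = 1.
Proof.
have cis_nat (n : nat) : cis (2 * pi * n%:R : R) = 1.
  by rewrite mulrC cis_natM /cis mulr_natl cos2pi sin2pi expr1n.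
case: (intP k) => [|n|n]; [exact: (cis_nat 0) | exact: cis_nat |].
have := cisD (2 * pi * n.+1%:R : R) (2 * pi * (- n.+1%:Z)%:~R).
by rewrite cis_nat mul1r => <-; rewrite rmorphN /= mulrN subrr cis0.
Qed.

(** By the half-angle formula cos x = 1 forces sin (x / 2) = 0, whereas
    sin is positive on ]0, pi[; hence the range allowed for x. *)
Lemma cis_neq1 {R : realType} (x : R) : x != 0 -> `|x| < 2 * pi -> cis x != 1.
Proof.
move=> x0 xlt; apply/eqP => -[cosx1 _].
have sin2 : sin (x / 2) ^+ 2 = 0.
  have := cos_mulr2n (x / 2); have := cos2Dsin2 (x / 2).
  have -> : (x / 2) *+ 2 = x by rewrite -mulr_natr divfK.
  by rewrite cosx1 => ? ?; lra.
have sinh0 : sin (`|x| / 2) = 0.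
  move/eqP: sin2; rewrite sqrf_eq0 => /eqP sin0.
  by case: (ger0P x) => _ //; rewrite mulNr sinN sin0 oppr0.
have : 0 < `|x| / 2 < pi by rewrite divr_gt0 ?normr_gt0 //=; lra.
by move/sin_gt0_pi; rewrite sinh0 ltxx.
Qed.

(** Orthogonality of the characters of Z/N, as a geometric sum whose ratio is
    an N-th root of unity. A signed frequency is used because both u - v and
    u + v occur below; the bound on it makes the ratio differ from 1. *)
Lemma sum_cis {R : realType} (N : nat) (k : int) : (`|k| < N)%N ->
  \sum_(0 <= t < N) cis (2 * pi / N%:R * t%:R * k%:~R : R)
  = (if k == 0 then N%:R else 0).
Proof.
move=> kN; case: eqVneq => [->|k0].
  rewrite (eq_bigr (fun=> 1)) => [|t _]; last by rewrite mulr0 cis0.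
  by rewrite sumr_const_nat subn0.
have N0 : N%:R != 0 :> R by rewrite pnatr_eq0; case: (N) kN.
set z := cis (2 * pi / N%:R * k%:~R : R).
have zN1 : z ^+ N = 1.
  rewrite -cis_natM -[RHS](@cis_period R k); congr cis.
  by field.
have z1 : z != 1.
  apply: cis_neq1.
    by rewrite !mulf_neq0 ?invr_eq0 ?intr_eq0 // gt_eqF ?pi_gt0.
  rewrite normrM ger0_norm ?divr_ge0 ?mulr_ge0 ?pi_ge0 //.
  rewrite -[_ / _ * _]mulrA gtr_pMr ?mulr_gt0 ?pi_gt0 //.
  rewrite mulrC ltr_pdivrMr ?mul1r; last by rewrite lt_neqAle eq_sym N0 ler0n.
  by rewrite -intr_norm -abszE -pmulrn ltr_nat.
have : (z - 1) * (\sum_(i < N) z ^+ i) = 0 by rewrite -subrX1 zN1 subrr.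
move/eqP; rewrite mulf_eq0 subr_eq0 (negPf z1) /= => /eqP geo0.
rewrite big_mkord -[RHS]geo0; apply: eq_bigr => t _.
by rewrite -cis_natM; congr cis; ring.
Qed.

Lemma double_cos {R : realType} (x : R) : (2 * cos x)%:C = cis x + cis (- x).
Proof.
rewrite /cis cosN sinN; apply/eqP.
by rewrite eq_complex /= subrr eqxx mulr_natl mulr2n eqxx.
Qed.

(** A cosine of frequency v carries the two characters - v and v, so the
    frequency u meets it at u = v with phase p, and again, with phase - p, at
    u + v = 0. The bound on u + v excludes the wrap-around u + v = N. *)
Lemma sum_cos_cis {R : realType} (N u v : nat) (p : R) : (u + v < N)%N ->
  \sum_(0 <= t < N) (2 * cos (p - 2 * pi / N%:R * t%:R * v%:R))%:C
                    * cis (2 * pi / N%:R * t%:R * u%:R)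
  = N%:R * ((v == u)%:R * cis p + (u + v == 0)%N%:R * cis (- p)).
Proof.
move=> uvN.
transitivity (cis p * (\sum_(0 <= t < N)
                 cis (2 * pi / N%:R * t%:R * (u%:Z - v%:Z)%:~R : R))
            + cis (- p) * (\sum_(0 <= t < N)
                 cis (2 * pi / N%:R * t%:R * (u + v)%N%:Z%:~R : R))).
  rewrite !mulr_sumr -big_split; apply: eq_bigr => t _ /=.
  rewrite double_cos mulrDl -!cisD rmorphB /= -!pmulrn natrD.
  by congr (cis _ + cis _); ring.
rewrite !sum_cis //; last by lia.
rewrite subr_eq0 !eqz_nat (eq_sym u v).
by case: (v == u); case: (u + v == 0)%N; rewrite /= ; ring.
Qed.

Lemma conj_polar {R : realType} (a x : R) :
  conjc (a%:C * cis x) = a%:C * cis (- x).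
Proof.
rewrite /cis cosN sinN; apply/eqP; rewrite eq_complex /=.
by apply/andP; split; apply/eqP; ring.
Qed.

Lemma normc_sqr {R : realType} (z : R[i]) :
  Normc.normc z ^+ 2 = complex.Re z ^+ 2 + complex.Im z ^+ 2.
Proof. by case: z => a b /=; rewrite sqr_sqrtr // addr_ge0 ?sqr_ge0. Qed.

(** The conjugate of A u is kept apart from A u so that the frequency 0, where
    both characters of the cosine coincide, is covered by the same formula. *)
Lemma dft_power {R : realType} (N : nat) (r : R) (A : nat -> R[i]) (phi : nat -> R)
    (J : nat -> R) (u : nat) : (u < N./2)%N ->
  (forall v : nat, (v < N./2)%N -> A v = (Normc.normc (A v))%:C * cis (phi v)) ->
  (forall t : nat, (t < N)%N ->
     J t = \sum_(0 <= v < N./2)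
         (Normc.normc (A v) ^+ 2 + r ^+ 2
          + 2 * r * Normc.normc (A v)
            * cos (phi v - 2 * pi / N%:R * t%:R * v%:R))) ->
  \sum_(0 <= t < N) (J t)%:C * cis (2 * pi / N%:R * t%:R * u%:R)
  = N%:R * ((u == 0)%:R *
       ((\sum_(0 <= v < N./2) (Normc.normc (A v) ^+ 2 + r ^+ 2))%:C
        + r%:C * conjc (A u))
    + r%:C * A u).
Proof.
move=> uN AE JE.
have halfN : (N./2 + N./2 <= N)%N by lia.
pose c v : R[i] := (Normc.normc (A v) ^+ 2 + r ^+ 2)%:C.
pose d v : R[i] := (r * Normc.normc (A v))%:C.
have dft_term v : (v < N./2)%N ->
    \sum_(0 <= t < N)
       (Normc.normc (A v) ^+ 2 + r ^+ 2 + 2 * r * Normc.normc (A v)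
          * cos (phi v - 2 * pi / N%:R * t%:R * v%:R))%:C
       * cis (2 * pi / N%:R * t%:R * u%:R)
    = N%:R * ((u == 0)%:R * c v
        + ((v == u)%:R * (r%:C * A v)
           + (u == 0)%:R * (v == u)%:R * (r%:C * conjc (A v)))).
  move=> vN.
  have -> : r%:C * A v = d v * cis (phi v).
    by rewrite [in LHS]AE // /d rmorphM mulrA.
  have -> : r%:C * conjc (A v) = d v * cis (- phi v).
    by rewrite [in LHS]AE // conj_polar /d rmorphM mulrA.
  transitivity (c v * (\sum_(0 <= t < N) cis (2 * pi / N%:R * t%:R * (u%:Z)%:~R : R))
     + d v * (\sum_(0 <= t < N) (2 * cos (phi v - 2 * pi / N%:R * t%:R * v%:R))%:C
                    * cis (2 * pi / N%:R * t%:R * u%:R))).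
    rewrite !mulr_sumr -big_split; apply: eq_bigr => t _ /=.
    rewrite /c /d -pmulrn mulrA -rmorphM -mulrDl -rmorphD /=.
    by congr (_%:C * _); ring.
  rewrite sum_cis ?sum_cos_cis; [|lia..].
  have -> : (u + v == 0)%N = (u == 0)%N && (v == u) by apply/idP/idP; lia.
  rewrite eqz_nat; by case: (v == u); case: (u == 0)%N => /=; ring.
(* sum over t first, for each fixed v *)
transitivity (\sum_(0 <= v < N./2) N%:R * ((u == 0)%:R * c v
        + ((v == u)%:R * (r%:C * A v)
           + (u == 0)%:R * (v == u)%:R * (r%:C * conjc (A v))))).
  rewrite -(eq_big_nat _ _ (fun v hv => dft_term v (andP hv).2)) exchange_big /=.
  apply: eq_big_nat => t /andP[_ tN].
  by rewrite JE // rmorph_sum mulr_suml.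
have pick (f : nat -> R[i]) : \sum_(0 <= v < N./2) (v == u)%:R * f v = f u.
  rewrite (bigD1_seq u) ?mem_index_iota ?iota_uniq //= eqxx mul1r big1 ?addr0 //.
  by move=> v /negPf ->; rewrite mul0r.
rewrite -mulr_sumr; congr (_ * _).
rewrite big_split [X in _ + X = _]big_split -mulr_sumr rmorph_sum /= /c.
under [X in _ + (_ + X) = _]eq_bigr do rewrite -mulrA.
by rewrite -mulr_sumr !pick; ring.
Qed.

Theorem proposition6 (R : realType) (N : nat) (r : R)
    (A : nat -> R[i]) (phi : nat -> R) (J : nat -> R)
    (N_even : ~~ odd N) (N_gt0 : (0 < N)%N) (r_gt0 : 0 < r)
    (A_polar : forall u : nat, (u < N./2)%N ->
       A u = (Normc.normc (A u))%:C * expC ('i%C * (phi u)%:C))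
    (J_def : forall tau : nat, (tau < N)%N ->
       J tau = \sum_(0 <= u < N./2)
         (Normc.normc (A u) ^+ 2 + r ^+ 2
          + 2 * r * Normc.normc (A u)
            * cos (phi u - 2 * pi / N%:R * tau%:R * u%:R))) :
  (forall u : nat, (0 < u)%N -> (u <= N./2 - 1)%N ->
     A u = (1 / (N%:R * r))%:C *
           \sum_(0 <= tau < N)
             (J tau)%:C * expC ('i%C * (2 * pi / N%:R * tau%:R * u%:R)%:C))
  /\
  Normc.normc (A 0%N + r%:C) ^+ 2 =
    1 / N%:R * \sum_(0 <= tau < N) J tau
    - (\sum_(1 <= u1 < N./2) Normc.normc (A u1) ^+ 2
       + \sum_(1 <= u1 < N./2) r ^+ 2).
Proof.
have N0 : N%:R != 0 :> R by rewrite pnatr_eq0 -lt0n.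
have AE v : (v < N./2)%N -> A v = (Normc.normc (A v))%:C * cis (phi v).
  by move=> vN; rewrite {1}A_polar // expC_im.
have NC : N%:R = N%:R%:C :> R[i] by rewrite rmorph_nat.
split=> [u u0 uN|].
  under eq_bigr do rewrite expC_im.
  rewrite (@dft_power _ _ r A phi) //; last by lia.
  rewrite eqn0Ngt u0 mul0r add0r mulrA NC.
  by rewrite mulrA -!rmorphM /= mul1r -mulrA mulVf ?mul1r // mulf_neq0 // gt_eqF.
have hN : (0 < N./2)%N by lia.
(* at frequency 0 the sum of A 0 and its conjugate is twice its real part *)
have /(congr1 (@complex.Re R)) := dft_power N r A phi J 0 hN AE J_def.
under eq_bigr do rewrite mulr0 cis0 mulr1.
rewrite -rmorph_sum NC /= => ->.
rewrite normc_sqr big_ltn //= big_split /= normc_sqr.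
case: (A 0%N) => a b /=; field; exact: N0.
Qed.
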